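(* The family $\mathcal{T}_{\mathcal{C}}$ of all rooted trees (with at least two vertices) together with all simple*-confluent epimorphisms between them is a projective Fraïssé family.
   Context: A graph is a pair $(V,E)$ with $E\subseteq V^2$ reflexive and symmetric; a tree is a finite graph in which any two distinct vertices are joined by a unique sequence of pairwise distinct vertices with consecutive ones adjacent. A rooted tree is a tree with distinguished root $r$; $x\le y$ iff the path from $r$ to $y$ contains $x$; edges are written $\langle a,b\rangle$ with $a<b$. Epimorphisms between rooted trees: vertex maps sending edges to edges, surjective on vertices and edges, root to root, order-preserving. Connected: not a union of two nonempty disjoint sets with no edges between. Confluent: for each connected $Q$ in the target, every component $K$ of $f^{-1}(Q)$ has $f(K)=Q$. Light: distinct vertices with the same image are never adjacent. Splitting edge map $S\to T$: $S$ obtained from $T$ by replacing an edge $\langle a,b\rangle$ by $\langle a,x\rangle,\langle x,b\rangle$ with a new vertex $x$; identity on $T$, $x\mapsto a$ or $x\mapsto b$. Adding edge map $S\to T$: $V(S)=V(T)\cup\{y\}$ with $y$ new and $E(S)=E(T)\cup\{\langle v,y\rangle\}$ for some $v\in T$; identity on $T$ and $y\mapsto v$. Simple*-monotone: composition of splitting edge maps and adding edge maps. Simple*-confluent: composition of finitely many epimorphisms each simple*-monotone or light confluent. A projective Fraïssé family is a class of finite rooted graphs with a fixed class of epimorphisms such that: countably many isomorphism types; the epimorphisms are closed under composition and contain identities; (JPP) any two members are images of a common member under fixed epimorphisms; (AP) for fixed $f\colon B\to A$, $g\colon C\to A$ there are $D$ and fixed $f_0\colon D\to B$, $g_0\colon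 D\to C$ with $f\circ f_0=g\circ g_0$. *)

(* Defs.v *)
From mathcomp Require Import all_boot.
Set Implicit Arguments. Unset Strict Implicit. Unset Printing Implicit Defensive.

Record rgraph := RGraph { vert : finType; adj : rel vert; root : vert }.
Arguments adj : clear implicits.
Arguments root : clear implicits.

Section Defs.
Variable A : rgraph.
Local Notation V := (vert A).
Local Notation E := (adj A).

Definition is_graph := reflexive E /\ symmetric E.

Definition spath (x y : V) (p : seq V) :=
  exists q, p = x :: q /\ last x q = y /\ uniq p /\ path E x q.

Definition is_tree :=
  is_graph /\ forall x y : V, x != y -> exists! p, spath x y p.

Definition tle (x y : V) := exists p, spath (root A) y p /\ x \in p.

Definition in_family := is_tree /\ 1 < #|V|.

Definition connected (Q : {set V}) :=
  ~ exists X Y : {set V}, [/\ X :|: Y = Q, X :&: Y = set0, X != set0, Y != set0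
        & forall a b, a \in X -> b \in Y -> ~~ E a b].

Definition component (S K : {set V}) :=
  [/\ K \subset S, K != set0, connected K
    & forall K' : {set V}, K \subset K' -> K' \subset S -> connected K' -> K' = K].
End Defs.

Section Maps.
Variables A B : rgraph.
Variable f : vert A -> vert B.

Definition epi :=
  [/\ (forall a b, adj A a b -> adj B (f a) (f b)),
      (forall c, exists a, f a = c),
      (forall c d, adj B c d -> exists a b, [/\ adj A a b, f a = c & f b = d]),
      f (root A) = root B
    & forall x y, tle x y -> tle (f x) (f y)].

Definition confluent :=
  forall Q : {set vert B}, connected Q ->
  forall K, component (f @^-1: Q) K -> f @: K = Q.

Definition light := forall x y, x != y -> f x = f y -> ~~ adj A x y.

(* splitting edge map: A is obtained from B by replacing the edge <a,b>
   by <a,x>,<x,b> with a new vertex x; f is the identity on the copy of B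
   and sends x to a or b *)
Definition splitting_edge_map :=
  exists (x : vert A) (a b : vert B),
  [/\ a != b, adj B a b, (f x == a) || (f x == b),
      {in [set~ x] &, injective f}
    & (forall c, exists2 u, u != x & f u = c)] /\
  [/\ root A != x,
      (forall u w, u != x -> w != x ->
         adj A u w = adj B (f u) (f w) &&
                     ~~ (((f u == a) && (f w == b)) || ((f u == b) && (f w == a))))
    & (forall u, u != x -> adj A u x = (f u == a) || (f u == b))].

(* adding edge map: A is obtained from B by adding a new vertex y and an
   edge <v,y>; f is the identity on the copy of B and sends y to v *)
Definition adding_edge_map :=
  exists (y : vert A) (v : vert B),
  [/\ f y = v,
      {in [set~ y] &, injective f}
    & (forall c, exists2 u, u != y & f u = c)] /\
  [/\ root A != y,
      (forall u w, u != y -> w != y -> adj A u w = adj B (f u) (f w))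
    & (forall u, u != y -> adj A u y = (f u == v))].

(* one factor of a simple*-confluent map: an epimorphism that is
   simple*-monotone (a splitting or adding edge map; longer compositions of
   these are obtained by chaining) or light confluent *)
Definition sc_step :=
  epi /\ [\/ splitting_edge_map, adding_edge_map | light /\ confluent].
End Maps.

Inductive simple_star_confluent : forall A B : rgraph, (vert A -> vert B) -> Prop :=
| ssc_step A B (f : vert A -> vert B) :
    in_family A -> in_family B -> sc_step f -> simple_star_confluent f
| ssc_comp A B C (f : vert A -> vert B) (g : vert B -> vert C) (h : vert A -> vert C) :
    in_family A -> sc_step f -> simple_star_confluent g ->
    (forall x, h x = g (f x)) -> simple_star_confluent h.

Definition rg_iso (A B : rgraph) :=
  exists f : vert A -> vert B,
    [/\ bijective f, f (root A) = root B & forall x y, adj B (f x) (f y) = adj A x y].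

Definition proj_fraisse_family (P : rgraph -> Prop)
    (M : forall A B : rgraph, (vert A -> vert B) -> Prop) :=
  [/\
      (exists F : nat -> rgraph, forall A, P A -> exists n, rg_iso A (F n)),
      (forall A B (f : vert A -> vert B), M A B f -> [/\ P A, P B & epi f]),
      (forall A B C (f : vert A -> vert B) (g : vert B -> vert C),
         M A B f -> M B C g -> M A C (fun x => g (f x)))
    & (forall A, P A -> M A A (fun x => x))] /\
  (
       (forall A B, P A -> P B -> exists C (f : vert C -> vert A) (g : vert C -> vert B),
          [/\ P C, M C A f & M C B g])
   /\
      (forall A B C (f : vert B -> vert A) (g : vert C -> vert A),
          M B A f -> M C A g ->
          exists D (f0 : vert D -> vert B) (g0 : vert D -> vert C),
            [/\ P D, M D B f0, M D C g0 & forall d, f (f0 d) = g (g0 d)])).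

(* Main.v *)
(* A tree is determined by its parent map, and a light confluent epimorphism is a
   map that commutes with parents and lifts children; a splitting or adding edge map
   deletes a single non-root vertex with at most one child, sending it to its parent
   or to its child.  Two light confluent maps are amalgamated by their fiber product,
   two deletions by inserting both vertices.  A deletion is pulled back along a light
   confluent map by inserting one vertex over each place that needs it, which is a
   chain of deletions.  Hence the squares for chains can be filled in a grid.  Joint
   projection reduces to amalgamation: deleting leaves turns any tree into one of
   height one, which has a light confluent map onto the tree with two vertices. *)
From mathcomp Require Import all_boot zify.
Require Import Defs.
Set Implicit Arguments. Unset Strict Implicit. Unset Printing Implicit Defensive.

Local Coercion vert : rgraph >-> Finite.type.

(** Heights only have to drop strictly from a vertex to its parent; they may differ from the
    distance to the root, so that every constructed tree can use whichever decreasing quantity is at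
    hand. A grid closes only if one side of each square does not grow. Pulling a deletion back along
    a light confluent map may cost many deletions, but the light confluent map stays a single one.
    The pullback starts from the section of the deletion [g] that misses the deleted vertex [y]: the
    light confluent map followed by this section behaves like a light confluent map except around
    [y]. Every inserted vertex repairs one such defect, and counting defects gives termination. The
    obstacle for two deletions is a common edge: one new vertex must be put above the other, and
    whether the square can commute depends on this order and on the ends to which the vertices are
    sent. *)

Record parent_structure (G : rgraph) := ParentStructure {
  par : G -> G;
  ht : G -> nat;
  par_root : par (root G) = root G;
  ht_par : forall u, u != root G -> ht (par u) < ht u;
  adjE : forall u w, adj G u w = [|| u == w, par u == w | par w == u] }.

Record ptree := PTree { gr :> rgraph; pst : parent_structure gr }.

Local Notation par_of T := (par (pst T)).
Local Notation ht_of T := (ht (pst T)).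
Local Notation rt T := (root (gr T)).

Lemma fconnect_step (V : finType) (f : V -> V) x y :
  fconnect f x y -> x = y \/ fconnect f (f x) y.
Proof.
move=> /iter_findex; case: (findex f x y) => [|n] /= H; first by left.
by right; rewrite -H -iterS iterSr fconnect_iter.
Qed.

(** * Paths and order in a tree given by parents; [fconnect p y x] says that [x] is an ancestor of
    [y] *)

Section Ptree.
Variable T : ptree.
Local Notation p := (par_of T).
Local Notation h := (ht_of T).
Local Notation r := (rt T).
Implicit Types x y z : T.

Lemma par_id x : p x = x -> x = r.
Proof.
move=> E; apply/eqP; apply: contraT => /(ht_par (pst T)).
by rewrite E ltnn.
Qed.

Lemma par_neq x : x != r -> p x != x.
Proof. by apply: contra_neq => /par_id. Qed.

Lemma ht_par_le x : h (p x) <= h x.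
Proof.
have [->|/(ht_par (pst T))/ltnW //] := eqVneq x r.
by rewrite par_root.
Qed.

Lemma ht_fconnect y x : fconnect p y x -> h x <= h y.
Proof.
move=> /iter_findex <-; elim: (findex _ _ _) => //= n IH.
exact: leq_trans (ht_par_le _) IH.
Qed.

Lemma fconnect_root y : fconnect p y r.
Proof.
have [n] := ubnP (h y); elim: n y => // n IH y /ltnSE le_n.
have [->|ny] := eqVneq y r; first exact: connect0.
apply: connect_trans (fconnect1 _ _) (IH _ _).
exact: leq_trans (ht_par _ ny) le_n.
Qed.

Lemma root_fconnect x : fconnect p r x -> x = r.
Proof.
move=> /iter_findex <-; elim: (findex _ _ _) => //= n ->.
exact: par_root.
Qed.

Lemma adj_sym x y : adj T x y = adj T y x.
Proof. by rewrite !(adjE (pst T)) eq_sym; congr (_ || _); rewrite orbC. Qed.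

Lemma adj_refl x : adj T x x.
Proof. by rewrite (adjE (pst T)) eqxx. Qed.

Lemma adj_par x : adj T (p x) x.
Proof. by rewrite (adjE (pst T)) eqxx !orbT. Qed.

Lemma adjP x y : adj T x y -> [\/ x = y, p x = y | p y = x].
Proof.
by rewrite (adjE (pst T)) => /or3P[]/eqP ?; [constructor 1 | constructor 2 | constructor 3].
Qed.

(** Both lie on the chain of ancestors of [y], so one is an ancestor of the other; if they differed,
    it would also be an ancestor of the common parent, against the heights. *)
Lemma fconnect_sibling y x z1 z2 : z1 != r -> z2 != r -> p z1 = x -> p z2 = x ->
  fconnect p y z1 -> fconnect p y z2 -> z1 = z2.
Proof.
move=> n1 n2 e1 e2 /iter_findex E1 /iter_findex E2.
move: E1 E2; set m := findex _ _ _; set n := findex _ _ _.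
have comp a b : fconnect p a b -> a != r -> b != r -> p a = x -> p b = x -> a = b.
  move=> H na nb ea eb; case: (fconnect_step H) => // /ht_fconnect.
  by rewrite ea -eb leqNgt (ht_par _ nb).
move=> E1 E2; case: (leqP m n) => [|/ltnW] /subnK lmn.
  apply: comp => //; rewrite -E2 -lmn iterD E1; exact: fconnect_iter.
apply/esym; apply: comp => //; rewrite -E1 -lmn iterD E2; exact: fconnect_iter.
Qed.

(** The only edge leaving the subtree below [z] joins [z] to [p z]. *)
Lemma path_in_subtree z w q : z != r -> fconnect p w z -> path (adj T) w q ->
  p z \notin w :: q -> fconnect p (last w q) z.
Proof.
move=> nz; elim: q w => [|w' q IH] w Hw //= /andP[aw pq] nin.
have nin' : p z \notin w' :: q by move: nin; rewrite inE negb_or => /andP[].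
apply: (IH w') => //.
case: (adjP aw) => [<- //|E|E].
- case: (fconnect_step Hw) => [Ez|]; last by rewrite E.
  by move: nin'; rewrite inE -E Ez eqxx.
- by apply: connect_trans Hw; rewrite -E fconnect1.
Qed.

(** The subtree below [x] can be entered only through [x]. *)
Lemma path_off_subtree x w q : ~~ fconnect p w x -> path (adj T) w q ->
  x \notin w :: q -> ~~ fconnect p (last w q) x.
Proof.
elim: q w => [|w' q IH] w Hw //= /andP[aw pq] nin.
have nin' : x \notin w' :: q by move: nin; rewrite inE negb_or => /andP[].
apply: (IH w') => //; apply: contra Hw => Hw'.
case: (adjP aw) => [-> //|E|E].
- by apply: connect_trans Hw'; rewrite -E fconnect1.
- case: (fconnect_step Hw') => [Ex|]; last by rewrite E.
  by move: nin'; rewrite Ex inE eqxx.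
Qed.

(** This is what makes simple paths unique: the end of the path alone decides its first step, up to
    the parent of [x] or down to the one child whose subtree contains the end. *)
Lemma simple_path_step x z q : uniq [:: x, z & q] -> path (adj T) x (z :: q) ->
  if fconnect p (last z q) x then [/\ p z = x, z != r & fconnect p (last z q) z]
  else z = p x.
Proof.
rewrite [uniq _]/= [path _ _ _]/= => /andP[xnin _] /andP[axz pq].
case: (adjP axz) => [E|E|E].
- by move: xnin; rewrite E inE eqxx.
- have nx : x != r.
    by apply: contraNneq xnin => E'; rewrite -E E' par_root inE eqxx.
  rewrite ifN ?E //; apply: path_off_subtree pq xnin.
  apply: contraL (ht_par (pst T) nx) => /ht_fconnect.
  by rewrite E -leqNgt.
- have nz : z != r.
    by apply: contraNneq xnin => E'; rewrite -E E' par_root inE eqxx.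
  have H : fconnect p (last z q) z by apply: path_in_subtree; rewrite ?connect0 ?E.
  by rewrite ifT //; apply: connect_trans H _; rewrite -E fconnect1.
Qed.

Lemma simple_path_unique x q1 q2 : uniq (x :: q1) -> uniq (x :: q2) ->
  path (adj T) x q1 -> path (adj T) x q2 -> last x q1 = last x q2 -> q1 = q2.
Proof.
elim: q1 x q2 => [|z1 q1 IH] x [|z2 q2] //.
- by move=> _ /= /andP[/negP H _] _ _ E; case: H; rewrite E mem_last.
- by move=> /= /andP[/negP H _] _ _ _ E; case: H; rewrite -E mem_last.
move=> u1 u2 p1 p2; rewrite [last _ _]/= [last x _ in RHS]/= => E.
have H1 := simple_path_step u1 p1; have H2 := simple_path_step u2 p2.
have Ez : z1 = z2.
  move: H1 H2; rewrite E; case: ifP => _; last by move=> -> ->.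
  by move=> [e1 n1 c1] [e2 n2 c2]; apply: (fconnect_sibling n1 n2 e1 e2 c1 c2).
rewrite -Ez in u2 p2 E *; congr (_ :: _).
by move: u1 u2 p1 p2 => /= /andP[_ ?] /andP[_ ?] /andP[_ ?] /andP[_ ?]; apply: (IH z1).
Qed.

(** Serves to turn [tle], which is defined by paths, into [fconnect]. *)
Lemma root_path y : exists q, [/\ path (adj T) r q, last r q = y, uniq (r :: q)
  & r :: q =i fconnect p y].
Proof.
have [n] := ubnP (h y); elim: n y => // n IH y /ltnSE le_n.
have [->|ny] := eqVneq y r.
  exists [::]; split=> // x; rewrite inE unfold_in.
  apply/eqP/idP => [->|/root_fconnect //]; exact: connect0.
have [|q [pq lq uq iq]] := IH (p y); first exact: leq_trans (ht_par _ ny) le_n.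
exists (rcons q y); split.
- by rewrite rcons_path pq lq adj_par.
- by rewrite last_rcons.
- rewrite -rcons_cons rcons_uniq uq andbT iq unfold_in.
  by apply: contraL (ht_par (pst T) ny) => /ht_fconnect; rewrite -leqNgt.
- move=> x; rewrite -rcons_cons mem_rcons inE iq !unfold_in.
  apply/orP/idP => [[/eqP ->|H]|/fconnect_step[->|]]; [exact: connect0 | | by left | by right].
  exact: connect_trans (fconnect1 _ _) H.
Qed.

Lemma ptree_tle x y : tle x y <-> fconnect p y x.
Proof.
have [q [pq lq uq iq]] := root_path y; split.
- move=> [_ [[q' [-> [lq' [uq' pq']]]] xin]].
  have E : q' = q by apply: (@simple_path_unique r) => //; rewrite lq'.
  by move: xin; rewrite E iq.
- by move=> H; exists (r :: q); split; [exists q | rewrite iq].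
Qed.

Lemma ptree_is_tree : is_tree T.
Proof.
split; first by split=> [x|x y]; [exact: adj_refl | exact: adj_sym].
move=> x y nxy.
have cr z : connect (adj T) z r.
  apply: connect_sub (fconnect_root z) => a b /eqP <-.
  by apply: connect1; rewrite adj_sym adj_par.
have: connect (adj T) x y.
  by apply: connect_trans (cr x) _; rewrite (sym_connect_sym adj_sym) cr.
case/connectP => q0 pq0 ->; case: (shortenP pq0) => q pq uq _.
exists (x :: q); split; first by exists q.
move=> _ [q' [-> [lq [uq' pq']]]]; congr (_ :: _).
exact: (simple_path_unique uq uq' pq pq' (esym lq)).
Qed.
End Ptree.

(** * Recovering the parent map from unique simple paths *)

Section ParentStructureOfTree.
Variables (A : rgraph) (treeA : is_tree A).
Local Notation E := (adj A).
Local Notation r := (root A).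

Let refl_adj x : E x x. Proof. by case: treeA => [[]]. Qed.
Let sym_adj x y : E x y = E y x. Proof. by case: treeA => [[_ ->]]. Qed.

Let simple_from x y q := [&& path E x q, uniq (x :: q) & last x q == y].

Let simple_from_unique x y q q' : simple_from x y q -> simple_from x y q' -> q = q'.
Proof.
move=> /and3P[p1 u1 /eqP l1] /and3P[p2 u2 /eqP l2].
have [Exy|nxy] := eqVneq x y.
  have loop s : uniq (x :: s) -> last x s = y -> s = [::].
    rewrite -Exy; case: s => //= z s /andP[/negP H _] E'; case: H.
    by rewrite -[X in X \in _]E' mem_last.
  by rewrite (loop q u1 l1) (loop q' u2 l2).
have [_ /(_ _ _ nxy)[s [_ H]]] := treeA.
have e1 : s = x :: q by apply: H; exists q.
have e2 : s = x :: q' by apply: H; exists q'.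
by case: (etrans (esym e1) e2).
Qed.

Let simple_from_ex y : exists q, simple_from r y q.
Proof.
have [<-|ny] := eqVneq r y; first by exists [::]; rewrite /simple_from /= eqxx.
have [_ /(_ _ _ ny)[s [[q [-> [lq [uq pq]]]] _]]] := treeA.
by exists q; rewrite /simple_from pq uq lq eqxx.
Qed.

Let pth y := xchoose (simple_from_ex y).

Let pthP y : simple_from r y (pth y). Proof. exact: xchooseP. Qed.

Let pthE y q : simple_from r y q -> pth y = q.
Proof. exact: simple_from_unique. Qed.

(** [pth y] omits the root and, for [y] other than the root, ends with [y]; without its last entry
    it leads to the parent. As [pth r] is empty, the root becomes its own parent. *)
Let tpar y := last r (take (size (pth y)).-1 (pth y)).

Let pth_root : pth r = [::].
Proof. by apply: pthE; rewrite /simple_from /= eqxx. Qed.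

Let tpar_rcons y q z : pth y = rcons q z ->
  [/\ tpar y = last r q, pth (tpar y) = q & y = z].
Proof.
move=> Ey; have := pthP y; rewrite Ey /simple_from last_rcons rcons_path -rcons_cons.
rewrite rcons_uniq => /and3P[/andP[pq _] /andP[_ uq] /eqP Ez].
have Et : tpar y = last r q.
  by rewrite /tpar Ey size_rcons /= -cats1 take_size_cat.
by split=> //; apply: pthE; rewrite /simple_from pq uq Et eqxx.
Qed.

Let pth_last y : y != r -> exists q, pth y = rcons q y.
Proof.
move=> ny; case/lastP E : (pth y) => [|q z].
  by have := pthP y; rewrite E /simple_from /= eq_sym (negPf ny).
by exists q; have [_ _ <-] := tpar_rcons E.
Qed.

Let tpar_adj y : E (tpar y) y.
Proof.
have [->|ny] := eqVneq y r; first by rewrite /tpar pth_root /= refl_adj.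
have [q Eq] := pth_last ny; have [-> _ _] := tpar_rcons Eq.
by have := pthP y; rewrite Eq /simple_from rcons_path => /and3P[/andP[]].
Qed.

(** If [y] is off the path to [x], appending [y] gives the path to [y]. If [y] is on it, the rest of
    the path and the edge from [y] to [x] are both simple, hence equal, and [y] comes just before
    [x]. *)
Let adj_tpar x y : E x y -> [\/ x = y, tpar x = y | tpar y = x].
Proof.
move=> Exy; have [->|nxy] := eqVneq x y; first by constructor 1.
have /and3P[px ux /eqP lx] := pthP x.
have short : simple_from y x [:: x].
  by rewrite /simple_from /= sym_adj Exy inE eq_sym nxy eqxx.
case: (boolP (y \in r :: pth x)) => [|nin]; last first.
  constructor 3; have Ey : pth y = rcons (pth x) y.
    apply: pthE; rewrite /simple_from rcons_path px lx Exy -rcons_cons rcons_uniq nin ux.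
    by rewrite last_rcons eqxx.
  by have [-> _ _] := tpar_rcons Ey.
rewrite inE => /orP[/eqP Er|].
  subst y; constructor 2.
  have Ex : pth x = rcons [::] x by apply: pthE.
  by have [-> _ _] := tpar_rcons Ex.
move=> yin; constructor 2.
have [q1 [q2 Eq]] : exists q1 q2, pth x = q1 ++ y :: q2.
  by case/splitPr: yin => q1 q2; exists q1, q2.
move: px ux lx; rewrite Eq cat_path last_cat -cat_cons cat_uniq /=.
move=> /and3P[_ _ p2] /and3P[_ _ /andP[ny2 u2]] l2.
have E2 : q2 = [:: x].
  by apply: simple_from_unique short; rewrite /simple_from p2 /= ny2 u2 l2 eqxx.
have Ex : pth x = rcons (rcons q1 y) x by rewrite Eq E2 -!cats1 -catA.
by have [-> _ _] := tpar_rcons Ex; rewrite last_rcons.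
Qed.

Lemma tree_parent_structure : parent_structure A.
Proof.
apply: (@ParentStructure A tpar (fun y => size (pth y))).
- by rewrite /tpar pth_root.
- move=> u nu; have [q Eq] := pth_last nu; have [_ -> _] := tpar_rcons Eq.
  by rewrite Eq size_rcons.
- move=> u w; apply/idP/or3P => [/adj_tpar[] ->|[]/eqP <-] //.
  + by constructor 1.
  + by constructor 2.
  + by constructor 3.
  + by rewrite sym_adj.
Qed.

End ParentStructureOfTree.

(** * Epimorphisms and light confluent maps in terms of parents *)

Definition pepi (A B : ptree) (f : A -> B) :=
  [/\ f (rt A) = rt B, (forall c, exists a, f a = c)
    & forall u, f (par_of A u) = f u \/ f (par_of A u) = par_of B (f u)].

(** Surjectivity on edges comes from climbing: starting over [d] and going up while the image stays
    [d], one stops at a vertex whose parent lies over the parent of [d]. *)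
Lemma pepi_epi (A B : ptree) (f : A -> B) : pepi f -> epi f.
Proof.
move=> [fr fs fp].
have fadj a b : adj A a b -> adj B (f a) (f b).
  case/adjP => [->|<-|<-]; first exact: adj_refl.
    by rewrite adj_sym; case: (fp a) => ->; rewrite ?adj_refl ?adj_par.
  by case: (fp b) => ->; rewrite ?adj_refl ?adj_par.
split=> //.
- have edge d : exists a, f (par_of A a) = par_of B d /\ f a = d.
    have [->|nd] := eqVneq d (rt B); first by exists (rt A); rewrite !par_root.
    have [a Ea] := fs d; have [n] := ubnP (ht_of A a).
    elim: n a Ea => // n IH a Ea /ltnSE le_n.
    have na : a != rt A by apply: contraNneq nd => E; rewrite -Ea E fr.
    case: (fp a) => E; last by exists a; rewrite E Ea.
    by apply: (IH (par_of A a)); [rewrite E | apply: leq_trans (ht_par _ na) le_n].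
  move=> c d /adjP[<-|<-|<-].
  + by have [a Ea] := fs c; exists a, a; rewrite adj_refl.
  + by have [a [E1 E2]] := edge c; exists a, (par_of A a); rewrite adj_sym adj_par.
  + by have [a [E1 E2]] := edge d; exists (par_of A a), a; rewrite adj_par.
- move=> x y /ptree_tle /iter_findex <-; apply/ptree_tle.
  elim: (findex _ _ _) => /= [|n IH]; first exact: connect0.
  apply: connect_trans IH _.
  by case: (fp (iter n (par_of A) y)) => ->; rewrite ?connect0 ?fconnect1.
Qed.

(** Monotonicity makes the image of the parent an ancestor of [f u]. Being adjacent to [f u], it is
    [f u] or its parent; the heights rule out an edge in the other direction. *)
Lemma epi_pepi (A B : ptree) (f : A -> B) : epi f -> pepi f.
Proof.
move=> [fadj fs _ fr fle]; split=> // u.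
have /ptree_tle H : tle (f (par_of A u)) (f u).
  by apply/fle/ptree_tle/fconnect1.
case: (adjP (fadj _ _ (adj_par u))) => [->|E|->]; [by left| |by right].
case: (fconnect_step H) => [->|H']; first by left.
have [E'|n] := eqVneq (f (par_of A u)) (rt B).
  by left; rewrite -E E' par_root.
have := ht_par (pst B) n; rewrite E => /leq_trans/(_ (ht_fconnect H)).
by rewrite ltnn.
Qed.

Lemma in_familyP (T : ptree) : in_family T <-> 1 < #|T|.
Proof. by split=> [[]|] //; split=> //; apply: ptree_is_tree. Qed.

Lemma comp_pepi (A B C : ptree) (f : A -> B) (g : B -> C) :
  pepi f -> pepi g -> pepi (fun x => g (f x)).
Proof.
move=> [fr fs fp] [gr gs gp]; split=> [|c|u]; first by rewrite fr.
- by have [b <-] := gs c; have [a <-] := fs b; exists a.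
- case: (fp u) => ->; [by left | exact: gp].
Qed.

Lemma eq_pepi (A B : ptree) (f g : A -> B) : f =1 g -> pepi f -> pepi g.
Proof.
move=> E [fr fs fp]; split=> [|c|u]; rewrite -?E //.
by have [a <-] := fs c; exists a.
Qed.

(** The third clause does not follow from the second: as the root is its own parent, a child of the
    root sent to the root would still commute with parents, but lightness forbids it. *)
Definition level_cover (A B : ptree) (f : A -> B) :=
  [/\ f (rt A) = rt B,
      forall u, f (par_of A u) = par_of B (f u),
      forall u, f u = rt B -> u = rt A
    & forall u d, d != rt B -> f u = par_of B d -> exists w, par_of A w = u /\ f w = d].

Lemma level_cover_pepi (A B : ptree) (f : A -> B) : level_cover f -> pepi f.
Proof.
move=> [fr fp _ fl]; split=> // [d|u]; last by right.
have [n] := ubnP (ht_of B d); elim: n d => // n IH d /ltnSE le_n.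
have [->|nd] := eqVneq d (rt B); first by exists (rt A).
have [|a Ea] := IH (par_of B d); first exact: leq_trans (ht_par _ nd) le_n.
by have [w [_ <-]] := fl a d nd Ea; exists w.
Qed.

(** A separation of the larger set restricts to one of [K] unless one side misses [K]; that side is
    then [a] alone, and the edge to [k] crosses. *)
Lemma connected_setU1 (A : rgraph) (K : {set A}) (k a : A) :
  connected K -> k \in K -> adj A k a -> adj A a k -> connected (a |: K).
Proof.
move=> cK kK ka ak [X [Y [XY XY0 X0 Y0 noE]]].
have [aK|aK] := boolP (a \in K).
  by apply: cK; exists X, Y; split=> //; rewrite XY; apply/setUidPr; rewrite sub1set.
have KU : (X :&: K) :|: (Y :&: K) = K.
  by rewrite -setIUl XY; apply/setIidPr; apply: subsetUr.
have KI : (X :&: K) :&: (Y :&: K) = set0 by rewrite -setIIl XY0 set0I.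
have only_a (Z : {set A}) : Z \subset X :|: Y -> Z != set0 -> Z :&: K = set0 -> a \in Z.
  move=> sZ /set0Pn[z zZ] ZK; have := subsetP sZ z zZ.
  rewrite XY => /setU1P[<- //|zK].
  by have : z \in Z :&: K by [rewrite inE zZ]; rewrite ZK inE.
have [XK|XK] := eqVneq (X :&: K) set0.
  have aX := only_a X (subsetUl _ _) X0 XK.
  have : k \in (X :&: K) :|: (Y :&: K) by rewrite KU.
  rewrite XK set0U inE => /andP[kY _].
  by have := noE _ _ aX kY; rewrite ak.
have [YK|YK] := eqVneq (Y :&: K) set0.
  have aY := only_a Y (subsetUr _ _) Y0 YK.
  have : k \in (X :&: K) :|: (Y :&: K) by rewrite KU.
  rewrite YK setU0 inE => /andP[kX _].
  by have := noE _ _ kX aY; rewrite ka.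
apply: cK; exists (X :&: K), (Y :&: K); split=> // x y.
by rewrite !inE => /andP[xX _] /andP[yY _]; apply: noE.
Qed.

Lemma connected_set1 (A : rgraph) (a : A) : connected [set a].
Proof.
move=> [X [Y [XY XY0 /set0Pn[x xX] /set0Pn[y yY] _]]].
have /set1P Ex : x \in [set a] by rewrite -XY inE xX.
have /set1P Ey : y \in [set a] by rewrite -XY inE yY orbT.
have : a \in X :&: Y by rewrite inE -{1}Ex -Ey xX yY.
by rewrite XY0 inE.
Qed.

Lemma subset_splitting (V : finType) (K Q : {set V}) : K \subset Q ->
  K :|: Q :\: K = Q /\ K :&: (Q :\: K) = set0.
Proof.
move=> /subsetP sKQ; split; apply/setP => z; rewrite !inE; last by case: (z \in K).
by have := sKQ z; case: (z \in K) => [->|].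
Qed.

Lemma level_cover_light (A B : ptree) (f : A -> B) : level_cover f -> light f.
Proof.
move=> [fr fp fo _] x y nxy Exy; apply/negP => /adjP[E|E|E].
- by rewrite E eqxx in nxy.
- have /fo Ex : f x = rt B by apply: par_id; rewrite -fp E -Exy.
  by move: nxy; rewrite -E Ex par_root eqxx.
- have /fo Ey : f y = rt B by apply: par_id; rewrite -fp E Exy.
  by move: nxy; rewrite -E Ey par_root eqxx.
Qed.

(** If [f @: K] were smaller than [Q], some edge of [Q] would leave it. Such an edge lifts, upwards
    by parents and downwards by lifting children, and its new end belongs to [K] by maximality. *)
Lemma level_cover_confluent (A B : ptree) (f : A -> B) : level_cover f -> confluent f.
Proof.
move=> [fr fp fo fl] Q cQ K [sK /set0Pn[k0 k0K] cK maxK].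
have sub : f @: K \subset Q.
  by apply/subsetP => _ /imsetP[k kK ->]; have := subsetP sK k kK; rewrite inE.
apply/eqP; rewrite eqEsubset sub /= -setD_eq0; apply/negPn/negP => nQ.
have ext k k' : k \in K -> adj A k k' -> f k' \in Q -> k' \in K.
  move=> kK ad fQ; have <- : k' |: K = K.
    apply: maxK; first exact: subsetUr.
      by apply/subsetP => z /setU1P[->|/(subsetP sK)] //; rewrite inE.
    by apply: connected_setU1 cK kK _ _ => //; rewrite adj_sym.
  by rewrite setU11.
have [|no_edge] := boolP [exists a in f @: K, exists b in Q :\: f @: K, adj B a b].
  case/exists_inP => _ /imsetP[k kK ->] /exists_inP[d]; rewrite inE => /andP[dK dQ].
  move=> /adjP[E|E|E].
  - by rewrite -E imset_f in dK.
  - have pK : par_of A k \in K.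
      by apply: ext kK _ _; rewrite ?fp ?E // adj_sym adj_par.
    by move: dK; rewrite -E -fp imset_f.
  - have nd : d != rt B.
      apply: contraNneq dK => Ed; rewrite Ed par_root in E.
      by apply/imsetP; exists k; rewrite // Ed E.
    have [k' [Ek' Ed]] := fl k d nd (esym E).
    have : k' \in K by apply: ext kK _ _; rewrite -?Ek' ?adj_par // Ed.
    by move=> /(imset_f f); rewrite Ed (negPf dK).
apply: cQ; exists (f @: K), (Q :\: f @: K); split=> //.
- by have [] := subset_splitting sub.
- by have [] := subset_splitting sub.
- by apply/set0Pn; exists (f k0); apply: imset_f.
- move=> a b aK bQ; move: no_edge; rewrite negb_exists_in => /forall_inP/(_ a aK).
  by rewrite negb_exists_in => /forall_inP/(_ b bQ).
Qed.

(** Lightness excludes that a vertex shares its image with its parent. If [u] over the parent of [d]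
    had no child over [d], then [u] alone would be a component above the edge from [par_of B d] to
    [d], contradicting confluence. *)
Lemma light_confluent_level_cover (A B : ptree) (f : A -> B) :
  pepi f -> light f -> confluent f -> level_cover f.
Proof.
move=> [fr fs fp] fL fC.
have nst u : u != rt A -> f (par_of A u) <> f u.
  move=> nu E; have := fL _ _ (par_neq nu) E.
  by rewrite adj_par.
have fpp u : f (par_of A u) = par_of B (f u).
  have [->|nu] := eqVneq u (rt A); first by rewrite par_root fr par_root.
  by case: (fp u) => // /(nst u nu).
have fo u : f u = rt B -> u = rt A.
  move=> Eu; have [//|nu] := eqVneq u (rt A).
  by case: (nst u nu); rewrite fpp Eu par_root.
split=> // u d nd Eu.
suff /existsP[w /andP[/eqP ? /eqP ?]] : [exists w, (par_of A w == u) && (f w == d)].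
  by exists w.
apply: contraT => none.
have Q2 : [set par_of B d; d] = d |: [set par_of B d] by rewrite setUC.
have cQ : connected [set par_of B d; d].
  rewrite Q2; apply: (@connected_setU1 B _ (par_of B d)).
  - exact: connected_set1.
  - exact: set11.
  - exact: adj_par.
  - by rewrite adj_sym adj_par.
suff cK : component (f @^-1: [set par_of B d; d]) [set u].
  have /setP/(_ d) := fC _ cQ _ cK.
  rewrite imset_set1 !inE eqxx orbT Eu => /eqP Ed.
  by have := par_neq nd; rewrite -Ed eqxx.
split; [by rewrite sub1set !inE Eu eqxx | by apply/set0Pn; exists u; rewrite set11
  | exact: connected_set1 |].
move=> K' sK' sQ cK'; apply/eqP; rewrite eqEsubset sK' andbT.
rewrite -setD_eq0; apply/negPn/negP => nK; apply: cK'.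
exists [set u], (K' :\ u); split=> //.
- by have [] := subset_splitting sK'.
- by have [] := subset_splitting sK'.
- by apply/set0Pn; exists u; rewrite set11.
move=> _ y /set1P-> /setD1P[nyu yK']; apply/negP.
have := subsetP sQ y yK'; rewrite !inE => yQ /adjP[E|E|E].
- by rewrite E eqxx in nyu.
- have nu : u != rt A by apply: contraNneq nyu => Eu'; rewrite -E Eu' par_root.
  have : ht_of B (f y) < ht_of B (f u).
    by rewrite -E fpp (ht_par (pst B)) //; apply: contraNneq nu => /fo ->.
  case/orP: yQ => /eqP ->; rewrite Eu ?ltnn //.
  by rewrite ltnNge ht_par_le.
- case/orP: yQ => /eqP Ey.
    by apply: (nst y); rewrite ?E ?Eu ?Ey //; apply: contraNneq nyu => Ey'; rewrite -E Ey' par_root.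
  by have /existsPn/(_ y) := none; rewrite E Ey !eqxx.
Qed.

(** * Splitting and adding edge maps as deletions of one vertex *)

Definition bypass (T : ptree) (x u : T) := if par_of T u == x then par_of T x else par_of T u.

(* An adding edge map if [x] is a leaf, a splitting edge map otherwise. *)
Record deletes_at (B A : ptree) (f : B -> A) (x : B) : Prop := DeletesAt {
  del_root : x != rt B;
  del_map_root : f (rt B) = rt A;
  del_inj : forall u w, u != x -> w != x -> f u = f w -> u = w;
  del_surj : forall a, exists u, (u != x) && (f u == a);
  del_par : forall u, u != x -> f (bypass x u) = par_of A (f u);
  del_child : forall u w, par_of B u = x -> par_of B w = x -> u = w;
  del_target : f x = f (par_of B x) \/ exists c, par_of B c = x /\ f x = f c }.

Definition deletion (B A : ptree) (f : B -> A) := exists x, deletes_at f x.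

Lemma bypass_neq (T : ptree) (x u : T) : x != rt T -> bypass x u != x.
Proof. by move=> nx; rewrite /bypass; case: (par_of T u =P x) => [_|/eqP //]; apply: par_neq. Qed.

Section DeletesAt.
Variables (B A : ptree) (f : B -> A) (x : B).
Hypothesis fx : deletes_at f x.

Lemma child_neq c : par_of B c = x -> c != x.
Proof.
move=> Ec; apply: contraTneq (par_neq (del_root fx)) => E.
by rewrite negbK -{1}E Ec.
Qed.

Lemma bypass_child c : par_of B c = x -> bypass x c = par_of B x.
Proof. by rewrite /bypass => ->; rewrite eqxx. Qed.

Lemma deletes_at_pepi : pepi f.
Proof.
split=> [|c|u]; first exact: del_map_root fx.
  by have [a /andP[_ /eqP]] := del_surj fx c; exists a.
have [->|nu] := eqVneq u x.
  case: (del_target fx) => [->|[c [Ec ->]]]; first by left.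
  by right; rewrite -(del_par fx (child_neq Ec)) bypass_child.
have := del_par fx nu; rewrite /bypass; case: eqP => [Eu|_]; last by right.
rewrite Eu; case: (del_target fx) => [->|[c [Ec ->]]]; first by right.
by left; rewrite (del_child fx Eu Ec).
Qed.

Lemma deletion_section : exists s : A -> B,
  [/\ forall a, s a != x, cancel s f & forall u, u != x -> s (f u) = u].
Proof.
have [s Hs] := fin_all_exists (del_surj fx).
exists s; split=> [a|a|u nu].
- by have /andP[] := Hs a.
- by have /andP[_ /eqP] := Hs a.
- by have /andP[n /eqP E] := Hs (f u); apply: (del_inj fx n nu E).
Qed.

Lemma del_eq u w : u != x -> w != x -> (f u == f w) = (u == w).
Proof. by move=> nu nw; apply/eqP/eqP => [/(del_inj fx nu nw)|->]. Qed.

Lemma deletes_at_step : sc_step f.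
Proof.
split; first exact/pepi_epi/deletes_at_pepi.
have nx := del_root fx; have npx := par_neq nx.
have nr : rt B != x by rewrite eq_sym.
have injx : {in [set~ x] &, injective f}.
  by move=> u w; rewrite !inE; apply: (del_inj fx).
have surjx c : exists2 u, u != x & f u = c.
  by have [u /andP[? /eqP ?]] := del_surj fx c; exists u.
(* Off [x] the map is injective, so adjacency in [A] can be read off in [B] with [bypass x] as
   parent map. *)
have adjA u w : u != x -> w != x ->
    adj A (f u) (f w) = [|| u == w, bypass x u == w | bypass x w == u].
  move=> nu nw; rewrite (adjE (pst A)) -!(del_par fx) //.
  by rewrite !del_eq ?bypass_neq.
have adjx u : u != x -> adj B u x = (u == par_of B x) || (par_of B u == x).
  by move=> nu; rewrite (adjE (pst B)) (negPf nu) /= orbC eq_sym.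
have [/existsP[c /eqP Ec]|noc] := boolP [exists c, par_of B c == x].
  have nc := child_neq Ec.
  have cE u : (par_of B u == x) = (u == c).
    by apply/eqP/eqP => [Eu|-> //]; apply: (del_child fx).
  have Efc : par_of A (f c) = f (par_of B x) by rewrite -(del_par fx nc) bypass_child.
  have hxc : ht_of B (par_of B x) < ht_of B c.
    by apply: leq_trans (ht_par (pst B) nx) _; rewrite -Ec ht_par_le.
  have npc : par_of B x != c by apply: contraTneq hxc => ->; rewrite ltnn.
  have nppc : par_of B (par_of B x) != c.
    by apply: contraTneq hxc => <-; rewrite -leqNgt ht_par_le.
  constructor 1; exists x, (f (par_of B x)), (f c).
  split; split=> //.
  + by rewrite del_eq.
  + by rewrite -Efc adj_par.
  + case: (del_target fx) => [->|[c' [Ec' ->]]]; first by rewrite eqxx.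
    by rewrite (del_child fx Ec' Ec) eqxx orbT.
  + move=> u w nu nw; rewrite adjA // (adjE (pst B)) !del_eq // /bypass !cE.
    have px y : y != x -> (x == y) = false by rewrite eq_sym => /negPf.
    have [->|nuc] := eqVneq u c; have [->|nwc] := eqVneq w c; rewrite ?Ec ?(px _ nw) ?(px _ nu) //=.
    * by rewrite [c == _]eq_sym (negPf npc) ?eqxx.
    * rewrite andbF /=; have [->|nwp] := eqVneq w (par_of B x).
        by rewrite (negPf nppc) andbF.
      by rewrite andbT.
    * rewrite (negPf nuc) /= orbF andbT orbF; have [->|nup] := eqVneq u (par_of B x).
        by rewrite (negPf nppc) andbF.
      by rewrite orbF andbT.
    *     *     * by rewrite !andbF /= andbT.
  + by move=> u nu; rewrite adjx // !del_eq // cE.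
have noc' u : par_of B u == x = false by apply: contraNF noc => ?; apply/existsP; exists u.
constructor 2; exists x, (f (par_of B x)); split; split=> //.
- by case: (del_target fx) => // -[c [Ec _]]; have := noc' c; rewrite Ec eqxx.
- by move=> u w nu nw; rewrite adjA // (adjE (pst B)) /bypass !noc'.
- by move=> u nu; rewrite adjx // noc' orbF del_eq.
Qed.
End DeletesAt.

(** The definitions of the edge maps mention only adjacency. Which neighbour of the new vertex is
    its parent is recovered from [f] being an epimorphism, by comparing heights. *)
Lemma sc_step_cases (B A : ptree) (f : B -> A) : sc_step f -> level_cover f \/ deletion f.
Proof.
move=> [/epi_pepi pf]; have [fr _ fp] := pf.
have del x : rt B != x -> {in [set~ x] &, injective f} ->
    (forall c, exists2 u, u != x & f u = c) ->
    (forall u w, par_of B u = x -> par_of B w = x -> u = w) ->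
    (f x = f (par_of B x) \/ exists c, par_of B c = x /\ f x = f c) ->
    (forall u, par_of B u = x -> u != x -> f (par_of B x) = par_of A (f u)) -> deletion f.
  move=> nr injx surjx chx tx px.
  have inj u w : u != x -> w != x -> f u = f w -> u = w.
    by move=> nu nw; apply: injx; rewrite !inE.
  exists x; split=> //; first by rewrite eq_sym.
    by move=> a; have [u nu <-] := surjx a; exists u; rewrite nu eqxx.
  move=> u nu; rewrite /bypass; case: (par_of B u =P x) => [Eu|/eqP npu]; first exact: px.
  have [->|nur] := eqVneq u (rt B); first by rewrite par_root fr par_root.
  (* Otherwise [f] identifies [u] with its parent, and injectivity off [x] makes [u] the root. *)
  by case: (fp u) => // /(inj _ _ npu nu) /par_id E; rewrite E eqxx in nur.
move=> [|[y [v [[Efy injy surjy] [nr adjA adjy]]]]|[]]; last first.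
- by move=> fL fC; left; apply: light_confluent_level_cover.
- right; have nyr : y != rt B by rewrite eq_sym.
  have noc u : par_of B u = y -> False.
    move=> Eu; have nu : u != y.
      by apply: contraNneq nyr => E; apply/eqP/par_id; rewrite -{1}E Eu.
    have fpy : f (par_of B y) = v.
      by apply/eqP; rewrite -adjy ?adj_par // par_neq.
    have fu : f u = v by apply/eqP; rewrite -adjy // -Eu adj_sym adj_par.
    have E : u = par_of B y by apply: injy; rewrite ?inE ?par_neq // fu fpy.
    have := ht_par (pst B) nyr; rewrite -E ltnNge -Eu ht_par_le //.
  apply: (del y) => //.
  + by move=> u w /noc.
  + by left; rewrite Efy; apply/esym/eqP; rewrite -adjy ?adj_par // par_neq.
  + by move=> u /noc.
move=> [x [a [b [[nab adjab fx injx surjx] [nr adjA adjx]]]]]; right.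
(* Splitting is symmetric in the two ends of the edge, so [b] may be taken as the lower one. *)
wlog Eab : a b nab adjab fx adjA adjx / a = par_of A b.
  move=> W; case: (adjP adjab) => [E|E|E]; first by rewrite E eqxx in nab.
    apply: (W b a) => //; first by rewrite eq_sym.
    - by rewrite adj_sym.
    - by rewrite orbC.
    - by move=> u w nu nw; rewrite orbC; apply: adjA.
    - by move=> u nu; rewrite orbC; apply: adjx.
  by apply: (W a b).
have nxr : x != rt B by rewrite eq_sym.
have npx := par_neq nxr.
have inj u w : u != x -> w != x -> f u = f w -> u = w.
  by move=> nu nw; apply: injx; rewrite !inE.
have nch c : par_of B c = x -> c != x.
  by move=> Ec; apply: contraNneq npx => E; rewrite -{1}E Ec.
have nbr u : u != x -> adj B u x -> f u = a \/ f u = b.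
  by move=> nu; rewrite adjx // => /orP[]/eqP; [left | right].
have chE c : par_of B c = x -> f c <> f (par_of B x).
  move=> Ec /(inj _ _ (nch c Ec) npx) E.
  by have := ht_par (pst B) nxr; rewrite -E ltnNge -Ec ht_par_le.
have adjc c : par_of B c = x -> adj B c x by move=> <-; rewrite adj_sym adj_par.
have nb : b != rt A by apply: contraNneq nab => E; rewrite Eab E par_root.
have hab : ht_of A a < ht_of A b by rewrite Eab (ht_par (pst A)).
have mono u : ht_of A (f (par_of B u)) <= ht_of A (f u).
  by case: (fp u) => ->; rewrite ?ht_par_le.
have [ua nua fua] := surjx a; have [ub nub fub] := surjx b.
(* If the parent of [x] lay over [b], the neighbour [ua] of [x] would be a child of [x]; by [mono]
   the height of [b] would then be at most that of [a]. *)
have pxa : f (par_of B x) = a.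
  case: (nbr _ npx (adj_par x)) => // Epx.
  have : adj B ua x by rewrite adjx // fua eqxx.
  case/adjP => [E|E|E].
  - by rewrite E eqxx in nua.
  - have := mono ua; rewrite E fua => h1; have := mono x.
    by rewrite Epx => /leq_trans/(_ h1); rewrite leqNgt hab.
  - by move: Epx nab; rewrite E fua => ->; rewrite eqxx.
have chb c : par_of B c = x -> f c = b.
  move=> Ec; case: (nbr _ (nch c Ec) (adjc c Ec)) => // Efc.
  by case: (chE c Ec); rewrite Efc pxa.
have pub : par_of B ub = x.
  have : adj B ub x by rewrite adjx // fub eqxx orbT.
  case/adjP => // E; first by rewrite E eqxx in nub.
  by move: nab; rewrite -pxa E fub eqxx.
apply: (del x) => //.
- move=> u w Eu Ew; apply: inj; rewrite ?nch //.
  by rewrite !chb.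
- case/orP: fx => /eqP ->; first by left.
  by right; exists ub.
- by move=> u Eu _; rewrite pxa chb.
Qed.

(** * Chains of maps and pasting of amalgamation squares *)

Definition map_class := forall A B : ptree, (A -> B) -> Prop.

(** Identities and composites are taken up to pointwise equality, which avoids functional
    extensionality. *)
Inductive chain (X : map_class) : map_class :=
| chain_id (A : ptree) (f : A -> A) : f =1 id -> chain X f
| chain_cons (A B C : ptree) (f : A -> B) (g : B -> C) (h : A -> C) :
    X A B f -> chain X g -> (forall x, h x = g (f x)) -> chain X h.

Lemma eq_chain (X : map_class) (A B : ptree) (f g : A -> B) :
  chain X f -> f =1 g -> chain X g.
Proof.
move=> Xf; elim: Xf g => {A B f} [A f fE|A B C f g h Xf Xg _ hE] k E.
  by apply: chain_id => x; rewrite -E fE.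
by apply: (chain_cons Xf Xg) => x; rewrite -E hE.
Qed.

Lemma chain_comp (X : map_class) (A B C : ptree) (f : A -> B) (g : B -> C) (h : A -> C) :
  chain X f -> chain X g -> (forall x, h x = g (f x)) -> chain X h.
Proof.
move=> Xf; elim: Xf C g h => {A B f} [A f fE|A B B' f f' f'' Xf _ IH f''E] C g h Xg hE.
  by apply: (eq_chain Xg) => x; rewrite hE fE.
apply: (chain_cons Xf (IH _ _ (fun x => g (f' x)) Xg _)) => // x.
by rewrite hE f''E.
Qed.

Lemma chain1 (X : map_class) (A B : ptree) (f : A -> B) : X A B f -> chain X f.
Proof. by move=> Xf; apply: (chain_cons Xf (@chain_id X B id (frefl id))). Qed.

Definition amalgamates (X Y : map_class) := forall (A B C : ptree) (f : B -> A) (g : C -> A),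
  X B A f -> Y C A g -> exists (D : ptree) (f0 : D -> B) (g0 : D -> C),
    [/\ Y D B f0, X D C g0 & forall d, f (f0 d) = g (g0 d)].

Lemma amalgamates_sym X Y : amalgamates X Y -> amalgamates Y X.
Proof.
move=> XY A B C f g Yf Xg; have [D [f0 [g0 [? ? E]]]] := XY _ _ _ g f Xg Yf.
by exists D, g0, f0; split=> // d; rewrite E.
Qed.

(** The [Y] side of a square may grow into a chain, but the [X] side stays a single map and can be
    handed on to the next square. *)
Lemma amalgamates_chain (X Y : map_class) :
  (forall (A B C : ptree) (f : B -> A) (g : C -> A), X B A f -> Y C A g ->
    exists (D : ptree) (f0 : D -> B) (g0 : D -> C),
      [/\ chain Y f0, X D C g0 & forall d, f (f0 d) = g (g0 d)]) ->
  amalgamates X (chain Y).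
Proof.
move=> XY A B C f g Xf Yg.
elim: Yg B f Xf => {A C g} [A g gE|C C' A g g' h Yg _ IH hE] B f Xf.
  by exists B, id, f; split=> //; apply: chain_id.
have [D' [f1 [g1 [Yf1 Xg1 E1]]]] := IH _ _ Xf.
have [D [f2 [g2 [Yf2 Xg2 E2]]]] := XY _ _ _ _ _ Xg1 Yg.
exists D, (fun d => f1 (f2 d)), g2; split=> [|//|d]; first exact: chain_comp Yf2 Yf1 _.
by rewrite E1 E2 hE.
Qed.

Lemma amalgamates_chainr X Y : amalgamates X Y -> amalgamates X (chain Y).
Proof.
move=> XY; apply: amalgamates_chain => A B C f g Xf Yg.
have [D [f0 [g0 [Yf0 Xg0 E]]]] := XY _ _ _ f g Xf Yg.
by exists D, f0, g0; split=> //; apply: chain1.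
Qed.

Lemma amalgamates_chainl X Y : amalgamates X Y -> amalgamates (chain X) Y.
Proof. by move=> /amalgamates_sym/amalgamates_chainr/amalgamates_sym. Qed.

(** * Amalgamating two light confluent maps *)

Section FiberProduct.
Variables (A B C : ptree) (f : B -> A) (g : C -> A).
Hypotheses (fL : level_cover f) (gL : level_cover g).

Definition fiber_product := {u : B * C | f u.1 == g u.2}.

Lemma fiber_eq (u w : fiber_product) :
  (val u).1 = (val w).1 -> (val u).2 = (val w).2 -> u = w.
Proof. by move=> E1 E2; apply: val_inj; case: (val u) (val w) E1 E2 => ? ? [? ?] /= -> ->. Qed.

Let root_eq : f (rt B) == g (rt C).
Proof. by case: fL => -> _ _ _; case: gL => ->. Qed.

Let par_eq (u : fiber_product) :
  f (par_of B (val u).1) == g (par_of C (val u).2).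
Proof.
case: fL => _ fp _ _; case: gL => _ gp _ _; rewrite fp gp; apply/eqP; congr (par _ _).
exact/eqP/(valP u).
Qed.

Definition fiber_root : fiber_product := Sub (rt B, rt C) root_eq.
Definition fiber_par u : fiber_product := Sub (par_of B (val u).1, par_of C (val u).2) (par_eq u).

Definition fiber_graph := @RGraph fiber_product
  (fun u w => [|| u == w, fiber_par u == w | fiber_par w == u]) fiber_root.

Definition fiber_parent_structure : parent_structure fiber_graph.
Proof.
apply: (@ParentStructure fiber_graph fiber_par (fun u => ht_of B (val u).1)) => //.
  by apply: fiber_eq; rewrite /= par_root.
(* The height of the first coordinate suffices: if that coordinate is the root, the pair lies over
   the root of [A], and so the second coordinate is the root as well. *)
move=> u nu; apply: (ht_par (pst B)); apply: contraNneq nu => E.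
have : f (val u).1 = rt A by rewrite E; case: fL.
rewrite (eqP (valP u)); case: gL => _ _ gr _ /gr E2.
by apply/eqP/fiber_eq.
Defined.
End FiberProduct.

(** A child in one factor is lifted by pairing it with a child in the other, which the opposite map
    provides over the same vertex of [A]. *)
Lemma amalgamates_level_cover : amalgamates level_cover level_cover.
Proof.
move=> A B C f g fL gL.
exists (PTree (fiber_parent_structure fL gL)), (fun u => (val u).1), (fun u => (val u).2).
have [fr fp fo fl] := fL; have [gr gp go gl] := gL.
split; last by move=> u; apply/eqP; apply: (valP u).
- split=> // [u E|u d nd Eu].
    have /go E2 : g (val u).2 = rt A by rewrite -(eqP (valP u)) E.
    by apply: fiber_eq.
  have Ec : g (val u).2 = par_of A (f d) by rewrite -(eqP (valP u)) Eu fp.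
  have nfd : f d != rt A by apply: contraNneq nd => /fo ->.
  have [c [E1 E2]] := gl _ _ nfd Ec.
  have P : f (d, c).1 == g (d, c).2 by rewrite /= E2.
  exists (Sub (d, c) P); split=> //.
  by apply: fiber_eq.
- split=> // [u E|u d nd Eu].
    have /fo E2 : f (val u).1 = rt A by rewrite (eqP (valP u)) E.
    by apply: fiber_eq.
  have Ec : f (val u).1 = par_of A (g d) by rewrite (eqP (valP u)) Eu gp.
  have nfd : g d != rt A by apply: contraNneq nd => /go ->.
  have [c [E1 E2]] := fl _ _ nfd Ec.
  have P : f (c, d).1 == g (c, d).2 by rewrite /= E2.
  exists (Sub (c, d) P); split=> //.
  by apply: fiber_eq.
Qed.

(** * Inserting a vertex, and amalgamating two deletions *)

Section Insertion.
Variables (B : ptree) (p : B) (q : pred B).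
Hypothesis q_child : forall u, q u -> u != rt B /\ par_of B u = p.

(* [None] is inserted below [p] and above those children of [p] that satisfy [q]. *)
Definition insertion_par (o : option B) : option B :=
  if o is Some u then (if q u then None else Some (par_of B u)) else Some p.

Definition insertion_graph := @RGraph (option B)
  (fun u w => [|| u == w, insertion_par u == w | insertion_par w == u]) (Some (rt B)).

Definition insertion_parent_structure : parent_structure insertion_graph.
Proof.
(* Doubling leaves an odd height free between [p] and its children for the inserted vertex. *)
apply: (@ParentStructure insertion_graph insertion_par
  (fun o => if o is Some u then (ht_of B u).*2 else (ht_of B p).*2.+1)) => //=.
  by case: ifP => [/q_child[]|_]; rewrite ?eqxx ?par_root.
case=> [u|] /= nu; last by lia.
have nr : u != rt B by apply: contraNneq nu => ->.
by have := ht_par (pst B) nr; case: ifP => [/q_child[_ <-]|_]; lia.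
Defined.

Definition insertion := PTree insertion_parent_structure.

Hypothesis q_unique : forall u w, q u -> q w -> u = w.

(** The default [t] of [odflt] is the image of the inserted vertex. *)
Lemma insertion_deletes_at (t : B) : t = p \/ q t ->
  deletes_at (odflt t : insertion -> B) (None : insertion).
Proof.
move=> ht; split=> //.
- by move=> [u|] [w|] //= _ _ ->.
- by move=> a; exists (Some a); rewrite /= eqxx.
- move=> [u|] // _; rewrite /bypass /=; case qu: (q u) => //=.
  by have [_ ->] := q_child qu.
- move=> [u|] [w|] //=; case: ifP => // qu; case: ifP => // qw _ _.
  by rewrite (q_unique qu qw).
- case: ht => [->|qt]; first by left.
  by right; exists (Some t); rewrite /= qt.
Qed.
End Insertion.

Lemma deletion_bypass_eq (B A : ptree) (f : B -> A) x u w :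
  deletes_at f x -> u != x -> w != x -> f w = par_of A (f u) -> w = bypass x u.
Proof.
move=> fx nu nw E; apply: (del_inj fx nw); first exact/bypass_neq/(del_root fx).
by rewrite (del_par fx).
Qed.

(* If [x] and [y] split the same edge of [A], inserting [y] below [x] fails only when
   [x] is sent to the lower end of that edge and [y] to the upper end; exchanging the
   two maps then helps. *)
Definition crossing (A B C : ptree) (f : B -> A) (g : C -> A) (x : B) (y : C) :=
  exists b c, [/\ par_of B b = x, par_of C c = y, f b = g c, f x = f b
    & g y = g (par_of C y)].

(** The common tree is [B] with a copy of [y] inserted; on a common edge it goes below [x]. The map
    to [C] deletes [x], following [f] by the section of [g]. *)
Lemma deletes_at_amalgam (A B C : ptree) (f : B -> A) (g : C -> A) (x : B) (y : C) :
  deletes_at f x -> deletes_at g y -> ~ crossing f g x y ->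
  exists (D : ptree) (f0 : D -> B) (g0 : D -> C),
    [/\ deletion f0, deletion g0 & forall d, f (f0 d) = g (g0 d)].
Proof.
move=> fx gy ncr.
have [s [sx sK Ks]] := deletion_section fx.
have [s' [sy sK' Ks']] := deletion_section gy.
have [fr gr] := (del_map_root fx, del_map_root gy).
have [nx ny] := (del_root fx, del_root gy).
have npy := par_neq ny; have npx := par_neq nx.
set v := g (par_of C y).
(* [q] marks the vertex of [B] that corresponds to the child of [y], if there is one. *)
pose q u := (u != x) && (par_of C (s' (f u)) == y).
have qU u w : q u -> q w -> u = w.
  move=> /andP[nu /eqP qu] /andP[nw /eqP qw]; apply: (del_inj fx nu nw).
  by apply: (can_inj sK'); apply: (del_child gy).
have qf u : q u -> par_of A (f u) = v.
  move=> /andP[nu /eqP qu].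
  by rewrite -(sK' (f u)) -(del_par gy) // bypass_child.
have qbp u : q u -> bypass x u = s v.
  move=> qu; have /andP[nu _] := qu; apply/esym.
  by apply: (deletion_bypass_eq fx) => //; rewrite sK qf.
(* The insertion point is [x] itself when both vertices split the same edge, and the copy [s v] of
   the parent of [y] otherwise. *)
pose p := if [pick u | q u] is Some u then par_of B u else s v.
have qp u : q u -> par_of B u = p.
  by move=> qu; rewrite /p; case: pickP => [w /(qU _ _ qu) ->|/(_ u)] //; rewrite qu.
have pP : p = s v \/ exists u, [/\ q u, par_of B u = x, p = x & par_of B x = s v].
  rewrite /p; case: pickP => [u qu|_]; last by left.
  have := qbp u qu; rewrite /bypass.
  by case: (par_of B u =P x) => [Eu ?|_ ?]; [right; exists u | left].
have q_child u : q u -> u != rt B /\ par_of B u = p.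
  move=> qu; split; last exact: qp.
  apply: contraTneq qu => ->; rewrite negb_and; apply/orP; right.
  have -> : s' (f (rt B)) = rt C.
    by rewrite fr -gr Ks' // eq_sym.
  by rewrite par_root eq_sym.
pose D := insertion q_child.
have childx b : q b -> par_of B b = x -> f x = f b -> g y = g (s' (f b)).
  move=> qb Eb Ex; case: (del_target gy) => [E|[c [Ec ->]]].
    case: ncr; exists b, (s' (f b)); split=> //.
      by move: qb => /andP[_ /eqP].
  by move: qb => /andP[_ /eqP qb]; rewrite (del_child gy Ec qb).
have [t tq tg] : exists2 t, t = p \/ q t & f t = g y.
  case: (del_target gy) => [E|[c [Ec E]]].
    exists p; first by left.
    rewrite E; case: pP => [->|[u [qu Eu -> Ex]]]; first by rewrite sK.
    case: (del_target fx) => [->|[c [Ec Efx]]]; first by rewrite Ex sK.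
    have := childx u qu Eu; rewrite Efx (del_child fx Eu Ec) E => /(_ erefl) ->.
    by rewrite sK'.
  have nc : c != y := child_neq gy Ec.
  exists (s (g c)); last by rewrite sK E.
  by right; rewrite /q sx sK Ks' // Ec eqxx.
(* Here the copy of [y] lies between [x] and [c], and [x] is sent to the lower end. In the map to
   [C], [x] must then be merged with the copy of [y]; by [childx], [y] is sent to the lower end
   too. *)
pose low := [exists c, [&& q c, par_of B c == x & f c == f x]].
pose F (o : D) : C := if o is Some u then
  (if (u == x) && low then y else s' (f u)) else y.
have Fs u : u != x -> F (Some u) = s' (f u) by rewrite /F => /negPf ->.
have qx : q x = false by rewrite /q eqxx.
have sval a : s' (f (s a)) = s' a by rewrite sK.
exists D, (odflt t : D -> B), F; split.
- by exists None; apply: insertion_deletes_at.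
- exists (Some x : D); split=> //.
  + by rewrite Fs 1?eq_sym // fr -gr Ks' // eq_sym.
  + move=> [u|] [w|] nu nw //.
    * rewrite !Fs // => /(can_inj sK')/(del_inj fx) -> //.
    * by rewrite Fs // => E; have := sy (f u); rewrite E /F eqxx.
    * by rewrite Fs // => E; have := sy (f w); rewrite -E /F eqxx.
  + move=> c; have [->|nc] := eqVneq c y; first by exists (None : D); rewrite /= eqxx.
    by exists (Some (s (g c)) : D); rewrite Fs // sval Ks' // eqxx andbT (sx (g c)).
  + move=> [u|] nu.
      rewrite Fs // /bypass /= qx; case qu: (q u) => /=.
        by have /andP[_ /eqP ->] := qu.
      transitivity (F (Some (bypass x u))).
        rewrite /bypass; case: (par_of B u =P x) => [->|/eqP npu]; first by rewrite eqxx.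
        by rewrite ifN.
      rewrite Fs ?bypass_neq // (del_par fx nu).
      have npu : par_of C (s' (f u)) != y by move: qu; rewrite /q nu /= => ->.
      apply: (del_inj gy) => //; rewrite sK' -{1}(sK' (f u)) -(del_par gy (sy _)).
      by rewrite /bypass (negPf npu).
    have -> : bypass (Some x : D) None = Some (s v).
      rewrite /bypass /= qx; case: pP => [->|[u [_ _ -> ->]]]; last by rewrite eqxx.
      by rewrite ifN //; apply: sx.
    by rewrite Fs // sval Ks'.
  + have noN w : q w = false -> p = x -> par_of B w = x -> False.
      move=> qw Ep Ew; case: pP => [Es|[u [qu Eu _ _]]].
        by have := sx v; rewrite -Es Ep eqxx.
      by rewrite (del_child fx Ew Eu) qu in qw.
    move=> [u|] [w|] //=.
    * case qu: (q u) => //; case qw: (q w) => // -[Eu] [Ew].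
      by rewrite (del_child fx Eu Ew).
    * by case qu: (q u) => // -[Eu] [Ep]; case: (noN u).
    * by case qw: (q w) => // -[Ep] [Ew]; case: (noN w).
  + have [lo|nlo] := boolP low.
      right; exists None; rewrite /= eqxx lo.
      by have /existsP[c /and3P[/qp <- /eqP -> _]] := lo.
    have FE : F (Some x) = s' (f x) by rewrite /F (negPf nlo) andbF.
    rewrite FE; case: (del_target fx) => [E|[c [Ec E]]].
      by left; rewrite /= qx Fs // E.
    right; exists (Some c); rewrite Fs ?(child_neq fx Ec) // -E; split=> //=.
    case qc: (q c); last by rewrite Ec.
    by case/existsP: nlo; exists c; rewrite qc Ec E !eqxx.
- move=> [u|] //=; case: ifP => [/andP[/eqP -> /existsP[c]]|_]; last by rewrite sK'.
  move=> /and3P[qc /eqP Ec /eqP Efc].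
  by rewrite (childx c) // sK' Efc.
Qed.

(** A crossing of [f] and [g] sends [x] to the lower end of the edge, a crossing of [g] and [f]
    sends it to the upper end; the ends differ, so one order always works. *)
Lemma amalgamates_deletion : amalgamates deletion deletion.
Proof.
move=> A B C f g [x fx] [y gy].
(* The boolean form of [crossing] allows the case distinction constructively. *)
have [/existsP[b /existsP[c /and5P[/eqP Eb /eqP Ec /eqP Ebc /eqP Exb /eqP Ey]]]|ncr] :=
  boolP [exists b, exists c, [&& par_of B b == x, par_of C c == y, f b == g c, f x == f b
  & g y == g (par_of C y)]].
  have nxb : f b != f (par_of B x).
    rewrite -(bypass_child Eb) (del_par fx (child_neq fx Eb)).
    have nb : f b != rt A.
      apply: contraTneq (ht_par (pst B) (del_root fx)) => E.
      have E' : b = rt B.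
        apply: (del_inj fx); rewrite ?(child_neq fx Eb) 1?eq_sym ?(del_root fx) //.
        by rewrite E (del_map_root fx).
      by have := del_root fx; rewrite -Eb E' par_root eqxx.
    by rewrite eq_sym par_neq.
  have [|D [g0 [f0 [? ? E]]]] := deletes_at_amalgam gy fx; last first.
    by exists D, f0, g0; split.
  move=> [c' [b' [_ _ _ _ E]]]; by rewrite -Exb E eqxx in nxb.
apply: (deletes_at_amalgam fx gy) => -[b [c [Eb Ec Ebc Exb Ey]]].
case/existsP: ncr; exists b; apply/existsP; exists c.
by rewrite Eb Ec Ebc Exb -Ey -Ebc !eqxx.
Qed.

(** * Pulling a deletion back along a light confluent map *)

Section LiftDeletion.
Variables (A C : ptree) (g : C -> A) (y : C).
Hypothesis gy : deletes_at g y.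

(* A level cover, except that [y] may be missing above a vertex sent to the parent
   of [y]: as a child if [y] is a leaf, as a vertex on an edge otherwise. *)
Record almost_cover (B : ptree) (k : B -> C) : Prop := AlmostCover {
  ac_root : k (rt B) = rt C;
  ac_only_root : forall b, k b = rt C -> b = rt B;
  ac_par : forall b, k (par_of B b) = par_of C (k b) \/
    (par_of C (k b) = y /\ k (par_of B b) = par_of C y);
  ac_lift : forall b d, d != rt C -> d != y -> k b = par_of C d ->
    exists b', par_of B b' = b /\ k b' = d;
  ac_lift_y : forall b c, k b = par_of C y -> par_of C c = y ->
    exists b', par_of B b' = b /\ (k b' = y \/ k b' = c) }.

(** Lower ends of the edges of [B] that jump over [y]. *)
Definition long_edges (B : ptree) (k : B -> C) : {set B} :=
  [set b | (par_of C (k b) == y) && (k (par_of B b) == par_of C y)].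

Definition missing_leaves (B : ptree) (k : B -> C) : {set B} :=
  [set b | (k b == par_of C y) && ~~ [exists b', (par_of B b' == b) && (k b' == y)]].

Let ny := del_root gy.
Let npy : par_of C y != y := par_neq ny.

Lemma almost_cover_level_cover (B : ptree) (k : B -> C) : almost_cover k ->
  long_edges k = set0 -> missing_leaves k = set0 -> level_cover k.
Proof.
move=> [kr ko kp kl kly] E1 E2; split=> // [u|u d nd Eu].
  case: (kp u) => // -[e1 e2]; have : u \in long_edges k by rewrite inE e1 e2 !eqxx.
  by rewrite E1 inE.
have [Ed|nd'] := eqVneq d y; last exact: kl.
have /negbT := in_set0 u; rewrite -{1}E2 inE Eu Ed eqxx /= negbK.
by case/existsP=> w /andP[/eqP ? /eqP ?]; exists w.
Qed.

Section OneInsertion.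
Variables (B : ptree) (k : B -> C) (p : B) (q : pred B).
Hypothesis kA : almost_cover k.
Hypothesis q_child : forall u, q u -> u != rt B /\ par_of B u = p.
Hypothesis kp : k p = par_of C y.
Hypothesis kq : forall u, q u -> par_of C (k u) = y.
Hypothesis q_full : forall c, par_of C c = y -> exists u, q u.

Let D := insertion q_child.
Let k' (o : D) : C := oapp k y o.

Lemma insertion_almost_cover : almost_cover k'.
Proof.
have [kr ko kpp kl kly] := kA; split=> //.
- by move=> [u|] /= E; [rewrite (ko _ E) | have := ny; rewrite E eqxx].
- move=> [u|]; last by left; rewrite /= kp.
  by rewrite /=; case qu: (q u); [left; rewrite /= kq | exact: kpp].
- move=> [u|] d nd ndy /= E.
    have [w [Ew Ed]] := kl u d nd ndy E; exists (Some w); split=> //=.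
    case qw: (q w); last by rewrite Ew.
    have [_ Ep] := q_child qw.
    by move: npy; rewrite -kp -Ep Ew E -Ed kq ?eqxx.
  (* Below the inserted vertex, the child of [y] is lifted to a marked vertex. *)
  have [u qu] := q_full (esym E).
  exists (Some u); rewrite /= qu; split=> //.
  exact: (del_child gy (kq qu) (esym E)).
- move=> [u|] c /= E Ec; last by move: npy; rewrite -E eqxx.
  have [w [Ew Ek]] := kly u c E Ec.
  case qw: (q w); last by exists (Some w); rewrite /= qw Ew.
  have [_ Ep] := q_child qw.
  by exists None; rewrite /= -Ep Ew; split=> //; left.
Qed.

Lemma insertion_long_edges : long_edges k' \subset Some @: (long_edges k :\: [set u | q u]).
Proof.
apply/subsetP => -[u|]; rewrite inE /=; last by rewrite (negPf npy).
case qu: (q u) => /=; first by rewrite [y == _]eq_sym (negPf npy) andbF.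
by move=> H; rewrite imset_f // !inE qu.
Qed.

Lemma insertion_missing_leaves : missing_leaves k' \subset Some @: (missing_leaves k :\ p).
Proof.
apply/subsetP => -[u|]; rewrite inE /=; last by rewrite [y == _]eq_sym (negPf npy).
move=> /andP[Eu /existsPn nu]; rewrite imset_f // !inE Eu /=; apply/andP; split.
  by apply: contraTneq (nu None) => ->; rewrite /= !eqxx.
apply/existsPn => w; apply: contra (nu (Some w)) => /andP[/eqP Ew Ek] /=.
rewrite Ek andbT; case qw: (q w); last by rewrite Ew.
by have := kq qw; have := npy; rewrite (eqP Ek) => /eqP.
Qed.
End OneInsertion.

(** Induction on the number of defects. The square commutes only after [g]: an inserted vertex lies
    over [y] in [C] but is sent to some [t] in [B], where only [g (k t) = g y] holds. *)
Lemma almost_cover_resolution (B : ptree) (k : B -> C) : almost_cover k ->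
  exists (D : ptree) (h : D -> B) (l : D -> C),
    [/\ chain deletion h, level_cover l & forall d, g (k (h d)) = g (l d)].
Proof.
have [n] := ubnP (#|long_edges k| + #|missing_leaves k|).
elim: n B k => // n IH B k /ltnSE le_n kA.
have step p (q : pred B) (q_child : forall u, q u -> u != rt B /\ par_of B u = p) t :
    (forall u w, q u -> q w -> u = w) -> t = p \/ q t -> k p = par_of C y ->
    (forall u, q u -> par_of C (k u) = y) -> (forall c, par_of C c = y -> exists u, q u) ->
    g (k t) = g y ->
    #|long_edges k :\: [set u | q u]| + #|missing_leaves k :\ p| < n ->
  exists (D : ptree) (h : D -> B) (l : D -> C),
    [/\ chain deletion h, level_cover l & forall d, g (k (h d)) = g (l d)].
  move=> qU ht kp kq q_full kt lt_n.
  pose k' (o : insertion q_child) : C := oapp k y o.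
  have [||D [h [l [hD lL E]]]] := IH (insertion q_child) k'.
  - apply: leq_ltn_trans lt_n; apply: leq_add.
      apply: leq_trans (subset_leq_card (insertion_long_edges k q_child)) _.
      exact: leq_imset_card.
    apply: leq_trans (subset_leq_card (insertion_missing_leaves q_child kq)) _.
    exact: leq_imset_card.
  - exact: insertion_almost_cover.
  exists D, (fun d => odflt t (h d)), l; split=> // [|d].
    apply: (chain_comp hD (chain1 _)) => //.
    by exists None; apply: insertion_deletes_at.
  by rewrite -E; case: (h d).
have [E1|/set0Pn[b]] := eqVneq (long_edges k) set0; last first.
  move=> bE; have := bE; rewrite inE => /andP[/eqP Eb /eqP Epb].
  have nb : b != rt B.
    by apply: contraNneq ny => E; rewrite -Eb E (ac_root kA) par_root.
  have q_child u : pred1 b u -> u != rt B /\ par_of B u = par_of B b by move=> /eqP ->.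
  have lt_n : #|long_edges k :\: [set u | pred1 b u]| + #|missing_leaves k :\ par_of B b| < n.
    have -> : [set u | pred1 b u] = [set b] by apply/setP => u; rewrite !inE.
    have := subset_leq_card (subD1set (missing_leaves k) (par_of B b)).
    by move: le_n; rewrite (cardsD1 b (long_edges k)) bE; lia.
  (* The inserted vertex goes to the end of the long edge that matches where [g] sends [y]. *)
  have [E|[c [Ec E]]] := del_target gy.
    apply: (step _ _ q_child (par_of B b)) => //; first by move=> u w /eqP -> /eqP ->.
    - by left.
    - by move=> u /eqP ->.
    - by exists b; rewrite /= eqxx.
    - by rewrite Epb.
  apply: (step _ _ q_child b) => //; first by move=> u w /eqP -> /eqP ->.
  - by right; rewrite /= eqxx.
  - by move=> u /eqP ->.
  - by exists b; rewrite /= eqxx.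
  - by rewrite E (del_child gy Eb Ec).
have [E2|/set0Pn[b]] := eqVneq (missing_leaves k) set0.
  exists B, id, k; split=> //; first exact: chain_id.
  exact: almost_cover_level_cover.
move=> bE; have := bE; rewrite inE => /andP[/eqP Eb /existsPn nob].
(* With no long edge left, a child of [y] would be lifted through a vertex over [y]; hence [y] is a
   leaf and the inserted vertex has no child. *)
have noc c : par_of C c = y -> False.
  move=> Ec; have [w [Ew [Ek|Ek]]] := ac_lift_y kA Eb Ec.
    by have := nob w; rewrite Ew Ek !eqxx.
  by have := in_set0 w; rewrite -E1 inE Ek Ec Ew Eb !eqxx.
have q_child u : pred0 u -> u != rt B /\ par_of B u = b by [].
apply: (step _ _ q_child b) => //; first by left.
- by move=> c /noc.
- by rewrite Eb; case: (del_target gy) => // -[c [/noc]].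
- by move: le_n; rewrite (cardsD1 b (missing_leaves k)) bE E1 set0D cards0.
Qed.

(** The section carries parents in [A] to [bypass y] in [C], so the only failures are edges jumping
    over [y] and absent copies of [y]. *)
Lemma section_almost_cover (B : ptree) (f : B -> A) (s : A -> C) : level_cover f ->
  (forall a, s a != y) -> cancel s g -> (forall u, u != y -> s (g u) = u) ->
  almost_cover (fun b => s (f b)).
Proof.
move=> [fr fp fo fl] sy sK Ks.
have sr : s (rt A) = rt C by rewrite -(del_map_root gy) Ks // eq_sym.
have spar a : s (par_of A a) = bypass y (s a).
  by apply: (deletion_bypass_eq gy); rewrite ?sK.
have lift b d : d != rt C -> d != y -> s (f b) = bypass y d ->
    exists b', par_of B b' = b /\ s (f b') = d.
  move=> nd ndy E.
  have nfd : g d != rt A by apply: contraNneq nd => E'; rewrite -(Ks d) // E' sr.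
  have [|w [Ew Ef]] := fl b (g d) nfd; first by rewrite -(del_par gy) // -E sK.
  by exists w; rewrite Ew Ef Ks.
split.
- by rewrite fr sr.
- by move=> b E; apply: fo; rewrite -(sK (f b)) E (del_map_root gy).
- move=> b; rewrite fp spar /bypass; case: eqP => [E|_]; last by left.
  by right.
- move=> b d nd ndy E; apply: lift => //; rewrite E /bypass ifN //.
  by rewrite -E.
- move=> b c E Ec; have nc : c != y := child_neq gy Ec.
  have nr : c != rt C by apply: contraTneq ny => E'; rewrite negbK -Ec E' par_root.
  have [|w [Ew Ek]] := lift b c nr nc; first by rewrite bypass_child.
  by exists w; split=> //; right.
Qed.
End LiftDeletion.

Lemma amalgamates_level_cover_deletion : amalgamates level_cover (chain deletion).
Proof.
apply: amalgamates_chain => A B C f g fL [y gy].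
have [s [sy sK Ks]] := deletion_section gy.
have [D [h [l [hD lL E]]]] := almost_cover_resolution gy (section_almost_cover gy fL sy sK Ks).
by exists D, h, l; split=> // d; rewrite -E sK.
Qed.

(** * Amalgamating arbitrary chains, and translating them to simple*-confluent maps *)

Definition block : map_class := fun A B f => level_cover f \/ chain deletion f.

(** Counting a whole chain of deletions as one block gives every square single maps on all four
    sides, although one deletion may pull back to many. *)
Lemma amalgamates_block : amalgamates (chain block) (chain block).
Proof.
apply/amalgamates_chainr/amalgamates_chainl => A B C f g [fL|fM] [gL|gM].
- have [D [f0 [g0 [? ? ?]]]] := amalgamates_level_cover fL gL.
  by exists D, f0, g0; split=> //; left.
- have [D [f0 [g0 [? ? ?]]]] := amalgamates_level_cover_deletion fL gM.
  by exists D, f0, g0; split=> //; [right | left].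
- have [D [f0 [g0 [? ? ?]]]] := amalgamates_sym amalgamates_level_cover_deletion fM gL.
  by exists D, f0, g0; split=> //; [left | right].
- have [D [f0 [g0 [? ? ?]]]] :=
    amalgamates_chainr (amalgamates_chainl amalgamates_deletion) fM gM.
  by exists D, f0, g0; split=> //; right.
Qed.

Lemma level_cover_id (A : ptree) (f : A -> A) : f =1 id -> level_cover f.
Proof.
by move=> E; split=> [|u|u|u d _]; rewrite !E // => ->; exists d; rewrite E.
Qed.

Lemma ssc_trans (A B C : rgraph) (f : A -> B) (g : B -> C) (h : A -> C) :
  simple_star_confluent f -> simple_star_confluent g -> (forall x, h x = g (f x)) ->
  simple_star_confluent h.
Proof.
move=> Hf; elim: Hf C g h => {A B f} [A B f FA _ sf|A B B' f f' f'' FA sf _ IH fE] C g h Hg hE.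
  exact: ssc_comp FA sf Hg hE.
apply: (ssc_comp FA sf (IH _ g (fun x => g (f' x)) Hg _)) => // x.
by rewrite hE fE.
Qed.

Lemma epi_card (A B : ptree) (f : A -> B) : pepi f -> 1 < #|B| -> 1 < #|A|.
Proof.
move=> [_ fs _] /leq_trans; apply.
rewrite -(_ : #|codom f| = #|B|) ?leq_image_card //.
by apply: eq_card => b; rewrite !inE; have [a <-] := fs b; rewrite codom_f.
Qed.

Lemma sc_step_ssc (A B : ptree) (f : A -> B) : sc_step f -> 1 < #|B| ->
  1 < #|A| /\ simple_star_confluent f.
Proof.
move=> sf cB; have cA : 1 < #|A| by case: sf => /epi_pepi/epi_card-> //.
by split=> //; apply: ssc_step => //; apply/in_familyP.
Qed.

Lemma level_cover_step (A B : ptree) (f : A -> B) : level_cover f -> sc_step f.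
Proof.
move=> fL; split; first exact/pepi_epi/level_cover_pepi.
by constructor 3; split; [apply: level_cover_light | apply: level_cover_confluent].
Qed.

Lemma chain_ssc (X : map_class) :
  (forall (A B : ptree) (f : A -> B), X A B f -> 1 < #|B| ->
    1 < #|A| /\ simple_star_confluent f) ->
  forall (A B : ptree) (f : A -> B), chain X f -> 1 < #|B| ->
    1 < #|A| /\ simple_star_confluent f.
Proof.
move=> XS A B f; elim=> {A B f} [A f fE|A B C f g h Xf _ IH hE] cB.
  (* The identity enters as a light confluent step, since [simple_star_confluent] has no empty
     composition. *)
  exact: (sc_step_ssc (level_cover_step (level_cover_id fE))).
have [cB' sg] := IH cB; have [cA sf] := XS _ _ _ Xf cB'.
by split=> //; apply: ssc_trans sf sg hE.
Qed.

Lemma block_ssc (A B : ptree) (f : A -> B) : chain block f -> 1 < #|B| ->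
  1 < #|A| /\ simple_star_confluent f.
Proof.
apply: chain_ssc => {}A {}B {}f [/level_cover_step|]; first exact: sc_step_ssc.
by apply: chain_ssc => {}A {}B {}f [x /deletes_at_step]; apply: sc_step_ssc.
Qed.

Lemma in_family_structure (A : rgraph) : in_family A -> inhabited (parent_structure A).
Proof. by move=> [tA _]; split; apply: tree_parent_structure. Qed.

Lemma ssc_in_family (A B : rgraph) (f : A -> B) :
  simple_star_confluent f -> in_family A /\ in_family B.
Proof. by elim=> {A B f} // A B C f g h FA _ _ [_ FC] _. Qed.

(** The parent structures at both ends are arbitrary, so that in a composition the one chosen on the
    middle tree serves both factors. *)
Lemma ssc_block (A B : rgraph) (f : A -> B) : simple_star_confluent f ->
  forall (sA : parent_structure A) (sB : parent_structure B),
    chain block (f : PTree sA -> PTree sB).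
Proof.
have step (C D : rgraph) (g : C -> D) : sc_step g ->
    forall (sC : parent_structure C) (sD : parent_structure D),
    block (g : PTree sC -> PTree sD).
  move=> sg sC sD; have [gL|gM] := @sc_step_cases (PTree sC) (PTree sD) g sg; first by left.
  by right; apply: chain1.
elim=> {A B f} [A B f _ _ sf|A B C f g h _ sf Hg IH hE] sA sC.
  exact/chain1/step.
have [[sB] _] : inhabited (parent_structure B) /\ True.
  by split=> //; apply/in_family_structure; case: (ssc_in_family Hg).
exact: (chain_cons (step _ _ _ sf sA sB) (IH sB sC) hE).
Qed.

Lemma ssc_epi (A B : rgraph) (f : A -> B) : simple_star_confluent f -> epi f.
Proof.
move=> Hf; have [/in_family_structure[sA] /in_family_structure[sB]] := ssc_in_family Hf.
have pe (X : map_class) : (forall (C D : ptree) (g : C -> D), X C D g -> pepi g) ->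
    forall (C D : ptree) (g : C -> D), chain X g -> pepi g.
  move=> XS C D g; elim=> {C D g} [C g gE|C D E g h k Xg _ IH kE].
    exact/level_cover_pepi/level_cover_id.
  by apply: eq_pepi (comp_pepi (XS _ _ _ Xg) IH) => x; rewrite kE.
apply: (@pepi_epi (PTree sA) (PTree sB) f); apply: (pe block _ _ _ _ (ssc_block Hf sA sB)).
move=> C D g [/level_cover_pepi //|]; apply: (pe deletion) => {}C {}D {}g [x].
exact: deletes_at_pepi.
Qed.

(** * Projecting every tree onto the tree with two vertices *)

Section LeafRemoval.
Variables (T : ptree) (y : T).
Hypotheses (ny : y != rt T) (leaf_y : forall u, par_of T u != y).

Definition leaf_removal_vertex := {u : T | u != y}.

Let root_neq : rt T != y. Proof. by rewrite eq_sym. Qed.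

Definition leaf_removal_par (u : leaf_removal_vertex) : leaf_removal_vertex :=
  Sub (par_of T (val u)) (leaf_y (val u)).

Definition leaf_removal_graph := @RGraph leaf_removal_vertex
  (fun u w => [|| u == w, leaf_removal_par u == w | leaf_removal_par w == u])
  (Sub (rt T) root_neq).

Definition leaf_removal_structure : parent_structure leaf_removal_graph.
Proof.
apply: (@ParentStructure leaf_removal_graph leaf_removal_par (fun u => ht_of T (val u))) => //.
  by apply: val_inj; rewrite /= par_root.
by move=> u nu; apply: (ht_par (pst T)); rewrite -val_eqE in nu.
Defined.

Definition leaf_removal := PTree leaf_removal_structure.

Lemma leaf_removal_deletion : exists f : T -> leaf_removal, deletion f.
Proof.
pose py : leaf_removal_vertex := Sub (par_of T y) (leaf_y y).
(* The default of [insubd] sends the removed leaf to its parent. *)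
pose f (u : T) : leaf_removal := insubd py u.
have fv u : u != y -> val (f u) = u by move=> nu; rewrite /f val_insubd nu.
exists f, y; split=> //.
- by apply: val_inj; rewrite fv.
- by move=> u w nu nw /(congr1 val); rewrite !fv.
- by move=> a; exists (val a); rewrite (valP a) -val_eqE /= fv // (valP a).
- move=> u nu; apply: val_inj; rewrite /bypass ifN // fv //=.
  by rewrite fv.
- by move=> u w E; have := leaf_y u; rewrite E eqxx.
- by left; apply: val_inj; rewrite (fv _ (leaf_y y)) /f val_insubd eqxx.
Qed.

Lemma card_leaf_removal : #|leaf_removal| < #|T|.
Proof.
rewrite card_sig [X in _ < X](cardD1 y) add1n ltnS.
by apply: subset_leq_card; apply/subsetP => u; rewrite !inE andbT.
Qed.
End LeafRemoval.

Definition edge_graph := @RGraph bool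
  (fun u w => [|| u == w, false == w | false == u]) false.

Definition edge_structure : parent_structure edge_graph.
Proof. by apply: (@ParentStructure edge_graph (fun _ => false) (fun b => b : nat)) => // -[]. Defined.

Definition edge_tree := PTree edge_structure.

Lemma to_edge_tree (T : ptree) : 1 < #|T| -> exists f : T -> edge_tree, chain block f.
Proof.
have [n] := ubnP #|T|; elim: n T => // n IH T /ltnSE le_n cT.
have [z nz] : exists z : T, z != rt T.
  apply/existsP; rewrite -[X in is_true X]negbK negb_exists; apply/negP => /forallP H.
  have : #|T| <= #|pred1 (rt T)|.
    by apply: subset_leq_card; apply/subsetP => u _; have := H u; rewrite negbK.
  by rewrite card1 leqNgt cT.
have [/forallP flat|/forallPn[u nu]] := boolP [forall u, par_of T u == rt T].
  exists (fun u => u != rt T : edge_tree); apply/chain1; left; split=> /=.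
  - by rewrite eqxx.
  - by move=> u; rewrite (eqP (flat u)) eqxx.
  - by move=> u /negbFE/eqP.
  - move=> u [] // _ /negbFE/eqP ->.
    by exists z; rewrite nz (eqP (flat z)).
(* A vertex of maximal height is a leaf. *)
case: (@arg_maxnP _ (rt T) predT (ht_of T)) => // y _ max_y.
have ny : y != rt T.
  apply: contraTneq (ht_par (pst T) nz) => E; rewrite -leqNgt.
  by apply: leq_trans (max_y z isT) _; rewrite E ht_fconnect ?fconnect_root.
have leaf_y w : par_of T w != y.
  have [->|nw] := eqVneq w (rt T); first by rewrite par_root eq_sym.
  by apply: contraTneq (max_y w isT) => <-; rewrite -ltnNge ht_par.
have [f fM] := leaf_removal_deletion ny leaf_y.
have [||g gC] := IH (leaf_removal ny leaf_y).
- exact: leq_trans (card_leaf_removal ny leaf_y) le_n.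
(* The parent of [u] is not the root, so two vertices survive the removal. *)
- apply/card_gt1P; exists (rt (leaf_removal ny leaf_y)), (Sub (par_of T u) (leaf_y u)).
  by split; rewrite // -val_eqE /= eq_sym.
exists (fun x => g (f x)); apply: (chain_cons _ gC) => //.
by right; apply: chain1.
Qed.

(** * Countability, and the main result *)

Definition coded_graph (n : nat) (c : {ffun 'I_n.+1 * 'I_n.+1 -> bool} * 'I_n.+1) :=
  RGraph (fun x y => c.1 (x, y)) c.2.

Lemma countably_many_graphs :
  exists F : nat -> rgraph, forall A : rgraph, exists n, rg_iso A (F n).
Proof.
pose code := {n : nat & ({ffun 'I_n.+1 * 'I_n.+1 -> bool} * 'I_n.+1)%type}.
pose F (m : nat) := if unpickle m is Some c then
  (* Numbers that code nothing give the graph with one vertex. *)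
  coded_graph (tagged (c : code)) else coded_graph ([ffun=> true], @ord0 0).
exists F => A.
have eA : #|A| = #|A|.-1.+1 by rewrite prednK //; apply/card_gt0P; exists (root A).
pose i (a : A) := cast_ord eA (enum_rank a).
pose j k : A := enum_val (cast_ord (esym eA) k).
have ij : cancel i j by move=> a; rewrite /i /j cast_ordK enum_rankK.
have ji : cancel j i by move=> a; rewrite /i /j enum_valK cast_ordKV.
pose c : code := Tagged (fun n => ({ffun 'I_n.+1 * 'I_n.+1 -> bool} * 'I_n.+1)%type)
  ([ffun u => adj A (j u.1) (j u.2)], i (root A)).
exists (pickle c); rewrite /F pickleK /=.
exists i; split=> //; first by exists j.
by move=> x y /=; rewrite ffunE /= !ij.
Qed.

Theorem theorem8p18 :
  proj_fraisse_family in_family (@simple_star_confluent).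
Proof.
have AP (A B C : rgraph) (f : B -> A) (g : C -> A) :
    simple_star_confluent f -> simple_star_confluent g ->
    exists D (f0 : vert D -> vert B) (g0 : vert D -> vert C),
      [/\ in_family D, simple_star_confluent f0, simple_star_confluent g0
        & forall d, f (f0 d) = g (g0 d)].
  move=> Hf Hg; have [FB FA] := ssc_in_family Hf; have [FC _] := ssc_in_family Hg.
  have [[sA] [sB] [sC]] : [/\ inhabited (parent_structure A),
    inhabited (parent_structure B) & inhabited (parent_structure C)].
    by split; apply: in_family_structure.
  have [D [f0 [g0 [Df Dg E]]]] := amalgamates_block (ssc_block Hf sB sA) (ssc_block Hg sC sA).
  have [_ cB] := FB; have [_ cC] := FC.
  have [cD Sf] := block_ssc Df cB; have [_ Sg] := block_ssc Dg cC.
  by exists D, f0, g0; split=> //; apply/in_familyP.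
split; [split | split].
- have [F HF] := countably_many_graphs; exists F => A _; exact: HF.
- by move=> A B f Hf; have [? ?] := ssc_in_family Hf; split=> //; apply: ssc_epi.
- by move=> A B C f g Hf Hg; apply: ssc_trans Hf Hg _.
- move=> A FA; apply: ssc_step => //.
  have [sA] := in_family_structure FA.
  exact: (level_cover_step (@level_cover_id (PTree sA) id (frefl id))).
- move=> A B FA FB.
  have [sA] := in_family_structure FA; have [sB] := in_family_structure FB.
  have [_ cA] := FA; have [_ cB] := FB.
  have [f Hf] := @to_edge_tree (PTree sA) cA; have [g Hg] := @to_edge_tree (PTree sB) cB.
  have c2 : 1 < #|edge_tree| by rewrite card_bool.
  have [_ Sf] := block_ssc Hf c2; have [_ Sg] := block_ssc Hg c2.
  have [D [f0 [g0 [? ? ? _]]]] := AP _ _ _ _ _ Sf Sg.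
  by exists D, f0, g0.
- exact: AP.
Qed.
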